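(* Let $\mathbb{F}$ be a field, $q\in\mathbb{F}$ and $f,g\in\mathbb{F}[h]$ with $\deg f>1$, and let $\mathcal{H}_q(f,g)$ be the corresponding quantum generalized Heisenberg algebra, with center $\mathsf{Z}(\mathcal{H}_q(f,g))$. (a) If $q$ is not a root of unity, then $\mathsf{Z}(\mathcal{H}_q(f,g))=\mathbb{F}$. (b) If $q$ is a primitive $\ell$-th root of unity and $\mathcal{H}_q(f,g)$ is conformal, with $a\in\mathbb{F}[h]$ such that $g(h)=\sigma(a)-qa$, then $\mathsf{Z}(\mathcal{H}_q(f,g))=\mathbb{F}[Z^\ell]$, where $Z=q(xy-a)$.
   Context: $\mathcal{H}_q(f,g)$ is the unital associative $\mathbb{F}$-algebra generated by $x,y,h$ with defining relations $hx=xf(h)$, $yh=f(h)y$, $yx-qxy=g(h)$. $\sigma$ denotes the unital $\mathbb{F}$-algebra endomorphism of $\mathbb{F}[h]$ with $\sigma(h)=f(h)$. $\mathcal{H}_q(f,g)$ is called conformal if there is some $a\in\mathbb{F}[h]$ such that $g(h)=\sigma(a)-qa$. $\mathbb{F}[Z^\ell]$ denotes the subalgebra generated by $Z^\ell$. *)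

(* Defs.v *)
From HB Require Import structures.
From mathcomp Require Import all_boot all_order all_algebra finmap.
From mathcomp Require Import boolp classical_sets.
From mathcomp Require Import monalg.

Set Implicit Arguments.
Unset Strict Implicit.
Unset Printing Implicit Defensive.

Import GRing.Theory.
Local Open Scope ring_scope.
Local Open Scope quotient_scope.

Definition center (A : nzRingType) : set A :=
  [set z | forall w : A, GRing.comm z w].
Arguments center A : clear implicits.

Inductive subalg_gen (F : fieldType) (A : algType F) (S : set A) : set A :=
  | subalg_gen_mem u : S u -> subalg_gen S u
  | subalg_gen_one : subalg_gen S 1
  | subalg_gen_lin c u v :
      subalg_gen S u -> subalg_gen S v -> subalg_gen S (c *: u + v)
  | subalg_gen_mul u v :
      subalg_gen S u -> subalg_gen S v -> subalg_gen S (u * v).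

(* Two-sided ideal generated by S; closure under opposites and scalars follows
   from the multiplication rules. *)
Inductive ideal_gen (A : nzRingType) (S : set A) : set A :=
  | ideal_gen_mem u : S u -> ideal_gen S u
  | ideal_gen_zero : ideal_gen S 0
  | ideal_gen_add u v : ideal_gen S u -> ideal_gen S v -> ideal_gen S (u + v)
  | ideal_gen_mull u v : ideal_gen S v -> ideal_gen S (u * v)
  | ideal_gen_mulr u v : ideal_gen S u -> ideal_gen S (u * v).

(* The free associative F-algebra on I, as the monoid algebra of the free
   monoid on I. *)
Notation free_alg F I := {malg F[{fmonom I}]}.

Section FreeAlg.
Context (F : fieldType) (I : choiceType).
Implicit Types (c : F) (u v w : free_alg F I).

Definition free_gen (i : I) : free_alg F I := << fmu i >>.

Lemma free_algC_comm c u : c%:MP * u = u * c%:MP.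
Proof.
rewrite !malgM_def /malgC fgmulUg fgmulgU; apply: eq_bigr => k _.
by rewrite mul1m mulm1 mulrC.
Qed.

Lemma free_scaleAr c u v : c *: (u * v) = u * (c *: v).
Proof. by rewrite -!mul_malgC !mulrA free_algC_comm. Qed.

End FreeAlg.

Section Presentation.
Context (F : fieldType) (q : F) (f g : {poly F}).

Local Notation A := (free_alg F 'I_3).
Local Notation fx := (free_gen F (0 : 'I_3)).
Local Notation fy := (free_gen F (1 : 'I_3)).
Local Notation fh := (free_gen F (2 : 'I_3)).

Definition eval_fh (p : {poly F}) : A := (map_poly (in_alg A) p).[fh].

Definition qgha_rel : set A :=
  [set r | [\/ r = fh * fx - fx * eval_fh f,
               r = fy * fh - eval_fh f * fy |
               r = fy * fx - q *: (fx * fy) - eval_fh g]].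

Definition qgha_ideal : {pred A} := [pred u | `[< ideal_gen qgha_rel u >]].

Lemma qgha_idealP u : reflect (ideal_gen qgha_rel u) (u \in qgha_ideal).
Proof. exact: asboolP. Qed.

Fact qgha_ideal_addr_closed : addr_closed qgha_ideal.
Proof.
split=> [|u v /qgha_idealP Iu /qgha_idealP Iv]; apply/qgha_idealP.
  exact: ideal_gen_zero.
exact: ideal_gen_add.
Qed.

Fact qgha_ideal_oppr_closed : oppr_closed qgha_ideal.
Proof.
move=> u /qgha_idealP Iu; apply/qgha_idealP.
by rewrite -mulN1r; apply: ideal_gen_mull.
Qed.

HB.instance Definition _ :=
  GRing.isAddClosed.Build A qgha_ideal qgha_ideal_addr_closed.
HB.instance Definition _ :=
  GRing.isOppClosed.Build A qgha_ideal qgha_ideal_oppr_closed.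

(* The ideal is proper: A acts on sequences of polynomials, x by shifting, h
   by multiplication with f^i(h) in position i, in such a way that the
   defining relations act by zero. *)
Section Proper.

Let V := nat -> {poly F}.
Let s (i : nat) (p : {poly F}) : {poly F} := iter i (comp_poly f) p.
Let c : nat -> {poly F} := fix c i := if i is j.+1 then q *: c j + s j g else 0.

Let act_gen (i : 'I_3) (v : V) : V := fun n =>
  match val i with
  | 0 => if n is m.+1 then v m else 0
  | 1 => c n.+1 * v n.+1
  | _ => s n 'X * v n
  end.

Let act_word (w : seq 'I_3) (v : V) : V := foldr act_gen v w.

Let act (u : A) (v : V) : V := fun n =>
  \sum_(m <- msupp u) u@_m *: act_word m v n.

Let actEw (d : {fset {fmonom 'I_3}}) u v n : (msupp u `<=` d)%fset ->
  act u v n = \sum_(m <- d) u@_m *: act_word m v n.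
Proof.
move=> le; rewrite /act (big_fset_incl _ le) //= => m md /mcoeff_outdom ->.
by rewrite scale0r.
Qed.

Let actU a m v n : act << a *g m >> v n = a *: act_word m v n.
Proof. by rewrite (actEw _ _ msuppU_le) big_seq_fset1 mcoeffUU. Qed.

Let actD u1 u2 v n : act (u1 + u2) v n = act u1 v n + act u2 v n.
Proof.
rewrite (actEw _ _ (msuppD_le _ _)).
rewrite (actEw _ _ (fsubsetUl (msupp u1) (msupp u2))).
rewrite (actEw _ _ (fsubsetUr (msupp u1) (msupp u2))).
by rewrite -big_split; apply: eq_bigr => m _; rewrite mcoeffD scalerDl.
Qed.

Let act0 v n : act 0 v n = 0.
Proof. by rewrite /act msupp0 big_seq_fset0. Qed.

Let act_sum (T : Type) (r : seq T) (G : T -> A) v n :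
  act (\sum_(i <- r) G i) v n = \sum_(i <- r) act (G i) v n.
Proof.
by apply: (big_morph (fun u => act u v n)) => [u1 u2|]; rewrite ?actD ?act0.
Qed.

Let act_gen_lin (T : Type) (r : seq T) (a : T -> F) (G : T -> V) i n :
  act_gen i (fun k => \sum_(j <- r) a j *: G j k) n =
  \sum_(j <- r) a j *: act_gen i (G j) n.
Proof.
rewrite /act_gen; case: (val i) => [|[|_]]; last 2 first.
- by rewrite mulr_sumr; apply: eq_bigr => j _; rewrite -scalerAr.
- by rewrite mulr_sumr; apply: eq_bigr => j _; rewrite -scalerAr.
by case: n => [|n] //; rewrite big1 // => j _; rewrite scaler0.
Qed.

Let act_word_lin (T : Type) (r : seq T) (a : T -> F) (G : T -> V) w n :
  act_word w (fun k => \sum_(j <- r) a j *: G j k) n =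
  \sum_(j <- r) a j *: act_word w (G j) n.
Proof.
elim: w n => [|i w IHw] n //=; rewrite -act_gen_lin.
by congr act_gen; apply/funext => k; rewrite IHw.
Qed.

Let actM u1 u2 v n : act (u1 * u2) v n = act u1 (act u2 v) n.
Proof.
rewrite malgME act_sum; apply: eq_bigr => m1 _.
rewrite act_sum act_word_lin scaler_sumr; apply: eq_bigr => m2 _.
by rewrite actU scalerA; congr (_ *: _); rewrite fmM /act_word foldr_cat.
Qed.

Let actN u v n : act (- u) v n = - act u v n.
Proof. by apply/eqP; rewrite -addr_eq0 -actD addNr act0. Qed.

Let actB u1 u2 v n : act (u1 - u2) v n = act u1 v n - act u2 v n.
Proof. by rewrite actD actN. Qed.

Let act_gen1 i v : act (free_gen F i) v = act_gen i v.
Proof. by apply/funext => n; rewrite /free_gen actU scale1r fmU. Qed.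

Let act1 v n : act 1 v n = v n.
Proof. by rewrite -mpolyC1E /malgC actU scale1r fm1. Qed.

Let actZ a u v n : act (a *: u) v n = a *: act u v n.
Proof.
rewrite -mul_malgC actM /malgC actU.
by rewrite fm1.
Qed.

Let sD i p1 p2 : s i (p1 + p2) = s i p1 + s i p2.
Proof. by elim: i => //= i ->; rewrite comp_polyD. Qed.

Let sM i p1 p2 : s i (p1 * p2) = s i p1 * s i p2.
Proof. by elim: i => //= i ->; rewrite comp_polyM. Qed.

Let sC i a : s i a%:P = a%:P.
Proof. by elim: i => //= i ->; rewrite comp_polyC. Qed.

Let act_eval p v n : act (eval_fh p) v n = s n p * v n.
Proof.
rewrite /eval_fh; elim/poly_ind: p v n => [|p a IHp] v n.
  by rewrite rmorph0 horner0 act0 -polyC0 sC mul0r.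
rewrite rmorphD rmorphM /= map_polyX map_polyC /= hornerD hornerMX hornerC.
rewrite actD actM IHp act_gen1 actZ act1 sD sM sC mulrDl mul_polyC.
by rewrite -mulrA.
Qed.

Let sX n : s n.+1 'X = s n f.
Proof. by rewrite /s iterSr /= comp_polyX. Qed.

Let c0 : c 0 = 0. Proof. by []. Qed.

Let cS n : c n.+1 = q *: c n + s n g.
Proof. by []. Qed.

Let actxE v n : act fx v n = if n is m.+1 then v m else 0.
Proof. by rewrite act_gen1. Qed.

Let actyE v n : act fy v n = c n.+1 * v n.+1.
Proof. by rewrite act_gen1. Qed.

Let acthE v n : act fh v n = s n 'X * v n.
Proof. by rewrite act_gen1. Qed.

(* Stated over an abstract algebra, since products of A unfold during matching. *)
Let act_rels (B : lalgType F) (E : B -> V -> V) (X Y H P Q : B) :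
  (forall u1 u2 v n, E (u1 - u2) v n = E u1 v n - E u2 v n) ->
  (forall u1 u2 v n, E (u1 * u2) v n = E u1 (E u2 v) n) ->
  (forall a u v n, E (a *: u) v n = a *: E u v n) ->
  (forall v n, E X v n = if n is m.+1 then v m else 0) ->
  (forall v n, E Y v n = c n.+1 * v n.+1) ->
  (forall v n, E H v n = s n 'X * v n) ->
  (forall v n, E P v n = s n f * v n) ->
  (forall v n, E Q v n = s n g * v n) -> forall v n,
  [/\ E (H * X - X * P) v n = 0, E (Y * H - P * Y) v n = 0 &
      E (Y * X - q *: (X * Y) - Q) v n = 0].
Proof.
move=> EB EM EZ EX EY EH EP EQ v n; split.
- rewrite EB !EM EH !EX.
  by case: n => [|n]; rewrite ?mulr0 ?subr0 // EP sX subrr.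
- by rewrite EB !EM EP !EY EH sX mulrCA subrr.
rewrite !EB EZ !EM EQ EY !EX.
case: n => [|n]; first by rewrite scaler0 subr0 cS c0 scaler0 add0r subrr.
by rewrite EY cS mulrDl -scalerAl [q *: _ + _]addrC addrK subrr.
Qed.

Let act_rel r v n : qgha_rel r -> act r v n = 0.
Proof.
have [] := act_rels actB actM actZ actxE actyE acthE (act_eval f) (act_eval g) v n.
move=> r1 r2 r3; case=> ->; [exact r1 | exact r2 | exact r3].
Qed.

Lemma qgha_ideal_proper : 1 \notin qgha_ideal.
Proof.
apply/negP => /qgha_idealP I1.
have act_ideal u : ideal_gen qgha_rel u -> forall v n, act u v n = 0.
  elim=> {u} [u /act_rel Iu||u1 u2 _ I1' _ I2|u1 u2 _ I2|u1 u2 _ I1'] v n.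
  - exact: Iu.
  - exact: act0.
  - by rewrite actD I1' I2 addr0.
  - rewrite actM; have -> : act u2 v = act 0 v.
      by apply/funext => k; rewrite I2 act0.
    by rewrite -actM mulr0 act0.
  - by rewrite actM I1'.
have := act_ideal _ I1 (fun=> 1) 0%N; rewrite act1.
by move/eqP; rewrite oner_eq0.
Qed.

End Proper.

Definition qgha : Type := {ideal_quot qgha_ideal}.

HB.instance Definition _ := Choice.on qgha.
HB.instance Definition _ := GRing.Zmodule.on qgha.

Definition qgha_pi (u : A) : qgha := \pi_({ideal_quot qgha_ideal}) u.

Lemma qgha_piP u v : qgha_pi u = qgha_pi v <-> ideal_gen qgha_rel (u - v).
Proof.
split=> [/eqP|/qgha_idealP]; last by rewrite Quotient.idealrBE => /eqP.
by rewrite /qgha_pi -Quotient.idealrBE => /qgha_idealP.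
Qed.

Definition qgha_one : qgha := qgha_pi 1.
Definition qgha_mul (a b : qgha) : qgha := qgha_pi (repr a * repr b).
Definition qgha_scale (k : F) (a : qgha) : qgha := qgha_pi (k *: repr a).

Lemma qgha_reprK (a : qgha) : qgha_pi (repr a) = a.
Proof. exact: reprK. Qed.

Lemma qgha_repr_pi u : ideal_gen qgha_rel (repr (qgha_pi u) - u).
Proof. by apply/qgha_piP; rewrite qgha_reprK. Qed.

Lemma qgha_piD u v : qgha_pi (u + v) = qgha_pi u + qgha_pi v.
Proof. exact: Quotient.pi_add. Qed.

Lemma qgha_pi0 : qgha_pi 0 = 0.
Proof. by apply: (addrI (qgha_pi 0)); rewrite -qgha_piD !addr0. Qed.

Lemma qgha_piM u v : qgha_pi (u * v) = qgha_mul (qgha_pi u) (qgha_pi v).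
Proof.
apply/esym/qgha_piP; set u' := repr _; set v' := repr _.
have -> : u' * v' - u * v = u' * (v' - v) + (u' - u) * v.
  by rewrite mulrBr mulrBl addrA addrNK.
apply: ideal_gen_add; [apply: ideal_gen_mull|apply: ideal_gen_mulr];
  exact: qgha_repr_pi.
Qed.

Lemma qgha_piZ k u : qgha_pi (k *: u) = qgha_scale k (qgha_pi u).
Proof.
apply/esym/qgha_piP; rewrite -scalerBr -mul_malgC.
by apply: ideal_gen_mull; exact: qgha_repr_pi.
Qed.

Fact qgha_mulA : associative qgha_mul.
Proof.
move=> a b d; rewrite -[a]qgha_reprK -[b]qgha_reprK -[d]qgha_reprK.
by rewrite -!qgha_piM mulrA.
Qed.

Fact qgha_mul1l : left_id qgha_one qgha_mul.
Proof. by move=> a; rewrite -[a]qgha_reprK -qgha_piM mul1r. Qed.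

Fact qgha_mul1r : right_id qgha_one qgha_mul.
Proof. by move=> a; rewrite -[a]qgha_reprK -qgha_piM mulr1. Qed.

Fact qgha_mulDl : left_distributive qgha_mul +%R.
Proof.
move=> a b d; rewrite -[a]qgha_reprK -[b]qgha_reprK -[d]qgha_reprK.
by rewrite -qgha_piD -!qgha_piM -qgha_piD mulrDl.
Qed.

Fact qgha_mulDr : right_distributive qgha_mul +%R.
Proof.
move=> a b d; rewrite -[a]qgha_reprK -[b]qgha_reprK -[d]qgha_reprK.
by rewrite -qgha_piD -!qgha_piM -qgha_piD mulrDr.
Qed.

Fact qgha_oner_neq0 : qgha_one != 0.
Proof.
apply/eqP; rewrite -qgha_pi0 => /qgha_piP; rewrite subr0 => /qgha_idealP.
exact/negP/qgha_ideal_proper.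
Qed.

HB.instance Definition _ := GRing.Zmodule_isNzRing.Build qgha
  qgha_mulA qgha_mul1l qgha_mul1r qgha_mulDl qgha_mulDr qgha_oner_neq0.

Fact qgha_scaleA k1 k2 (a : qgha) :
  qgha_scale k1 (qgha_scale k2 a) = qgha_scale (k1 * k2) a.
Proof. by rewrite -[a]qgha_reprK -!qgha_piZ scalerA. Qed.

Fact qgha_scale1 : left_id 1 qgha_scale.
Proof. by move=> a; rewrite -[a]qgha_reprK -qgha_piZ scale1r. Qed.

Fact qgha_scaleDr : right_distributive qgha_scale +%R.
Proof.
move=> k a b; rewrite -[a]qgha_reprK -[b]qgha_reprK.
by rewrite -qgha_piD -!qgha_piZ -qgha_piD scalerDr.
Qed.

Fact qgha_scaleDl a : {morph qgha_scale^~ a : k1 k2 / k1 + k2}.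
Proof.
by move=> k1 k2; rewrite /= -[a]qgha_reprK -!qgha_piZ -qgha_piD scalerDl.
Qed.

HB.instance Definition _ := GRing.Zmodule_isLmodule.Build F qgha
  qgha_scaleA qgha_scale1 qgha_scaleDr qgha_scaleDl.

Fact qgha_scaleAl (k : F) (a b : qgha) : k *: (a * b) = k *: a * b.
Proof.
rewrite -[a]qgha_reprK -[b]qgha_reprK.
by rewrite /GRing.scale /GRing.mul /= -!(qgha_piM, qgha_piZ) scalerAl.
Qed.

HB.instance Definition _ := GRing.Lmodule_isLalgebra.Build F qgha qgha_scaleAl.

Fact qgha_scaleAr (k : F) (a b : qgha) : k *: (a * b) = a * (k *: b).
Proof.
rewrite -[a]qgha_reprK -[b]qgha_reprK.
by rewrite /GRing.scale /GRing.mul /= -!(qgha_piM, qgha_piZ) free_scaleAr.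
Qed.

HB.instance Definition _ := GRing.Lalgebra_isAlgebra.Build F qgha qgha_scaleAr.

Definition qx : qgha := qgha_pi fx.
Definition qy : qgha := qgha_pi fy.
Definition qh : qgha := qgha_pi fh.

Lemma qgha_pi_eval p : qgha_pi (eval_fh p) = horner_alg qh p.
Proof.
rewrite /eval_fh /horner_alg /horner_morph.
elim/poly_ind: p => [|p a IHp]; first by rewrite !rmorph0 !horner0 qgha_pi0.
rewrite !rmorphD !rmorphM /= !map_polyX !map_polyC /= !hornerD !hornerMX.
by rewrite !hornerC qgha_piD qgha_piM IHp qgha_piZ.
Qed.

Lemma qgha_hx : qh * qx = qx * horner_alg qh f.
Proof.
rewrite -qgha_pi_eval /GRing.mul /= -!qgha_piM; apply/qgha_piP; apply: ideal_gen_mem; exact: Or31.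
Qed.

Lemma qgha_yh : qy * qh = horner_alg qh f * qy.
Proof.
rewrite -qgha_pi_eval /GRing.mul /= -!qgha_piM; apply/qgha_piP; apply: ideal_gen_mem; exact: Or32.
Qed.

Lemma qgha_yx : qy * qx - q *: (qx * qy) = horner_alg qh g.
Proof.
apply/eqP; rewrite subr_eq -qgha_pi_eval /GRing.scale /GRing.mul /=.
rewrite -!qgha_piM -qgha_piZ -qgha_piD; apply/eqP/qgha_piP.
by apply: ideal_gen_mem; apply: Or33; rewrite opprD addrCA addrC.
Qed.

End Presentation.

(* The endomorphism of F[h] sending h to f(h). *)
Definition sigma (F : fieldType) (f : {poly F}) : {poly F} -> {poly F} :=
  fun p => p \Po f.

(* Main.v *)
Require Import Defs.
From HB Require Import structures.
From mathcomp Require Import all_boot all_order all_algebra finmap.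
From mathcomp Require Import boolp classical_sets functions.
From mathcomp Require Import monalg.

(** Write s for the substitution p |-> p \Po f.  The relations let every
    element be written as a sum of terms x^i p(h) y^j, and the whole argument
    rests on the fact that the coefficients p are then unique.  Uniqueness is
    obtained by letting the generators act on arrays v i j of polynomials,
    thought of as the formal sums of the x^i (v i j)(h) y^j: the formulas are
    those that left multiplication ought to satisfy, one checks that they obey
    the defining relations ([reg_act_rel]), and applying an element to the array
    that stands for 1 reads off its coefficients ([qgha_coord_mono]).

    Let z be central, with coefficients z_ij.  Comparing z h with h z gives
    (s^i(h) - s^j(h)) z_ij = 0; as deg f > 1, the degrees (deg f)^i of the
    s^i(h) are distinct, so z_ij = 0 unless i = j ([center_coord_diag]).
    Comparing z x with x z then gives, for p_i = z_ii,
      p_i = q^i s(p_i) + c_{i+1} p_{i+1},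
    where c_{i+1} comes from y x^{i+1} = q^{i+1} x^{i+1} y + x^i c_{i+1}(h).
    At the last n with p_n != 0 this reads p_n = q^n s(p_n); comparing degrees,
    p_n is a nonzero constant, and therefore q^n = 1 ([center_coord_top]).

    If q is not a root of unity, this forces n = 0 and z is a scalar.  If q is a
    primitive l-th root of unity, then l divides n.  In the conformal case Z
    commutes with h and satisfies Z x = q x Z and y Z = q Z y, so that Z^l is
    central; moreover Z^n has a nonzero constant as its coefficient at x^n y^n
    and none at x^i y^j for i > n ([coord_Zn_gt], [coord_Zn_top]).  Subtracting a
    multiple of Z^n, which is a power of Z^l, from z lowers n, and induction on n
    concludes.

    The computations with products are done in an arbitrary algebra subject to
    the three relations and, for the center, provided with a coefficient map;
    the presented algebra is shown to have such a map only at the end. *)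

Set Implicit Arguments.
Unset Strict Implicit.
Unset Printing Implicit Defensive.

Import GRing.Theory.
Local Open Scope ring_scope.
Local Open Scope classical_set_scope.

(** * Actions of a free algebra *)
Section FreeAction.
Context (F : fieldType) (I : choiceType) (V : lmodType F).
Variable T : I -> {linear V -> V}.
Implicit Types (u : free_alg F I) (v : V) (w : seq I).

Definition word_act w v : V := foldr (fun i => T i) v w.

Definition free_act u v : V := \sum_(m <- msupp u) u@_m *: word_act m v.

Fact word_act_is_linear w : linear (word_act w).
Proof. by move=> a v1 v2; elim: w => //= i w ->; rewrite linearP. Qed.

HB.instance Definition _ w :=
  GRing.isLinear.Build F V V _ (word_act w) (word_act_is_linear w).

Lemma free_actEw (d : {fset {fmonom I}}) u v : (msupp u `<=` d)%fset ->
  free_act u v = \sum_(m <- d) u@_m *: word_act m v.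
Proof.
move=> le; rewrite /free_act (big_fset_incl _ le) //= => m _ /mcoeff_outdom ->.
by rewrite scale0r.
Qed.

Lemma free_actU a m v : free_act << a *g m >> v = a *: word_act m v.
Proof. by rewrite (free_actEw _ msuppU_le) big_seq_fset1 mcoeffUU. Qed.

Lemma free_act_gen i v : free_act (free_gen F i) v = T i v.
Proof. by rewrite free_actU scale1r fmU. Qed.

Lemma free_act1 v : free_act 1 v = v.
Proof. by rewrite -mpolyC1E free_actU scale1r fm1. Qed.

Lemma free_act0 v : free_act 0 v = 0.
Proof. by rewrite /free_act msupp0 big_seq_fset0. Qed.

Lemma free_actD u1 u2 v : free_act (u1 + u2) v = free_act u1 v + free_act u2 v.
Proof.
rewrite (free_actEw _ (msuppD_le _ _)).
rewrite (free_actEw _ (fsubsetUl (msupp u1) (msupp u2))).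
rewrite (free_actEw _ (fsubsetUr (msupp u1) (msupp u2))).
by rewrite -big_split; apply: eq_bigr => m _; rewrite mcoeffD scalerDl.
Qed.

Lemma free_actN u v : free_act (- u) v = - free_act u v.
Proof. by apply/eqP; rewrite -addr_eq0 -free_actD addNr free_act0. Qed.

Fact free_act_is_linear u : linear (free_act u).
Proof.
move=> a v1 v2; rewrite scaler_sumr -big_split; apply: eq_bigr => m _ /=.
by rewrite linearP scalerDr !scalerA mulrC.
Qed.

HB.instance Definition _ u :=
  GRing.isLinear.Build F V V _ (free_act u) (free_act_is_linear u).

Lemma free_actM u1 u2 v : free_act (u1 * u2) v = free_act u1 (free_act u2 v).
Proof.
have act_sum (J : Type) (r : seq J) (G : J -> free_alg F I) :
    free_act (\sum_(i <- r) G i) v = \sum_(i <- r) free_act (G i) v.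
  by apply: (big_morph (free_act^~ v)) => [w1 w2|]; rewrite ?free_actD ?free_act0.
rewrite malgME act_sum; apply: eq_bigr => m1 _.
rewrite act_sum linear_sum scaler_sumr; apply: eq_bigr => m2 _ /=.
by rewrite free_actU linearZ /= scalerA fmM /word_act foldr_cat.
Qed.

Lemma free_actZ a u v : free_act (a *: u) v = a *: free_act u v.
Proof. by rewrite -mul_malgC free_actM free_actU fm1. Qed.

(** The relations that define [qgha] have this shape or that of
    [free_act_rel3]. *)
Lemma free_act_rel2 u1 u2 u3 u4 v :
  free_act (u1 * u2 - u3 * u4) v =
  free_act u1 (free_act u2 v) - free_act u3 (free_act u4 v).
Proof. by rewrite free_actD free_actN; congr (_ - _); apply: free_actM. Qed.

Lemma free_act_rel3 a u1 u2 u3 u4 u5 v :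
  free_act (u1 * u2 - a *: (u3 * u4) - u5) v =
  free_act u1 (free_act u2 v) - a *: free_act u3 (free_act u4 v) - free_act u5 v.
Proof.
rewrite 2!free_actD 2!free_actN free_actZ.
by congr (_ - _ *: _ - _); apply: free_actM.
Qed.

Lemma free_act_ideal (S : set (free_alg F I)) :
  (forall r v, S r -> free_act r v = 0) ->
  forall u v, ideal_gen S u -> free_act u v = 0.
Proof.
move=> S0 u v Iu; elim: Iu v => {u} [u Su||u1 u2 _ I1 _ I2|u1 u2 _ I2|u1 u2 _ I1] v.
- exact: S0.
- exact: free_act0.
- by rewrite free_actD I1 I2 addr0.
- by rewrite free_actM I2 linear0.
- by rewrite free_actM I1.
Qed.

End FreeAction.

(** * The regular module *)
Section RegularModule.
Context (F : fieldType) (q : F) (f g : {poly F}).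
Implicit Types (p : {poly F}).

Definition sigman n p : {poly F} := iter n (comp_poly f) p.

Fact sigman_is_linear n : linear (sigman n).
Proof. by move=> a p1 p2; elim: n => //= n ->; rewrite linearP. Qed.

Fact sigman_is_monoid_morphism n : monoid_morphism (sigman n).
Proof.
split; first by elim: n => //= n ->; rewrite rmorph1.
by move=> p1 p2; elim: n => //= n ->; rewrite rmorphM.
Qed.

HB.instance Definition _ n :=
  GRing.isLinear.Build F {poly F} {poly F} _ (sigman n) (sigman_is_linear n).
HB.instance Definition _ n :=
  GRing.isMonoidMorphism.Build {poly F} {poly F} (sigman n)
    (sigman_is_monoid_morphism n).

Lemma sigmanC n a : sigman n a%:P = a%:P.
Proof. by rewrite -alg_polyC linearZ /= rmorph1. Qed.

(** The polynomial c_n such that y x^n = q^n x^n y + x^(n-1) c_n(h) and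
    y^n x = q^n x y^n + c_n(h) y^(n-1) for n > 0; see [mul_y_xn] and [mul_yn_x]. *)
Fixpoint yx_coef n : {poly F} :=
  if n is m.+1 then q *: yx_coef m + sigman m g else 0.

(* The array v stands for the formal, possibly infinite, sum of the
   x^i (v i j)(h) y^j. *)
Local Notation reg_mod := (nat -> nat -> {poly F}).
Implicit Types v : reg_mod.

Lemma yx_coefS n : yx_coef n.+1 = q *: yx_coef n + sigman n g.
Proof. by []. Qed.

Lemma sigmanS n p : sigman n.+1 p = sigman n p \Po f.
Proof. by []. Qed.
Arguments yx_coef : simpl never.
Arguments sigman : simpl never.

Lemma reg_linE a v1 v2 i j : (a *: v1 + v2) i j = a *: v1 i j + v2 i j.
Proof. by []. Qed.

(** Left multiplication by x, by p(h) and by y, as dictated by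
    p(h) x^i = x^i (s^i p)(h) and y x^i p(h) y^j =
    q^i x^i (s p)(h) y^(j+1) + x^(i-1) (c_i p)(h) y^j. *)
Definition reg_x v : reg_mod := fun i j => if i is m.+1 then v m j else 0.
Definition reg_h p v : reg_mod := fun i j => sigman i p * v i j.
Definition reg_y v : reg_mod := fun i j =>
  (if j is m.+1 then q ^+ i *: (v i m \Po f) else 0) + yx_coef i.+1 * v i.+1 j.

Fact reg_x_is_linear : linear reg_x.
Proof.
move=> a v1 v2; apply/funext => -[|i]; apply/funext => j; last by [].
by rewrite reg_linE /= scaler0 addr0.
Qed.

Fact reg_h_is_linear p : linear (reg_h p).
Proof.
move=> a v1 v2; apply/funext => i; apply/funext => j.
by rewrite reg_linE /reg_h reg_linE mulrDr scalerAr.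
Qed.

Fact reg_y_is_linear : linear reg_y.
Proof.
move=> a v1 v2; apply/funext => i; apply/funext => j.
rewrite reg_linE /reg_y scalerDr addrACA; congr (_ + _).
  case: j => [|j]; first by rewrite scaler0 addr0.
  by rewrite reg_linE linearP /= scalerDr !scalerA mulrC.
by rewrite reg_linE mulrDr scalerAr.
Qed.

HB.instance Definition _ :=
  GRing.isLinear.Build F reg_mod reg_mod _ reg_x reg_x_is_linear.
HB.instance Definition _ p :=
  GRing.isLinear.Build F reg_mod reg_mod _ (reg_h p) (reg_h_is_linear p).
HB.instance Definition _ :=
  GRing.isLinear.Build F reg_mod reg_mod _ reg_y reg_y_is_linear.

Definition reg_gen (i : 'I_3) : {linear reg_mod -> reg_mod} :=
  match val i with 0 => reg_x | 1 => reg_y | _ => reg_h 'X end.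

Local Notation reg_act := (free_act reg_gen).

Lemma reg_act_eval p v : reg_act (eval_fh p) v = reg_h p v.
Proof.
rewrite /eval_fh; elim/poly_ind: p v => [|p a IHp] v.
  rewrite rmorph0 horner0 free_act0.
  by apply/funext => i; apply/funext => j; rewrite /reg_h rmorph0 mul0r.
rewrite rmorphD rmorphM /= map_polyX map_polyC /= hornerD hornerMX hornerC.
rewrite free_actD free_actM IHp free_act_gen free_actZ free_act1.
apply/funext => i; apply/funext => j.
rewrite /reg_h rmorphD rmorphM /= sigmanC mulrDl mul_polyC -mulrA.
by [].
Qed.

Lemma sigmanXS n : sigman n.+1 'X = sigman n f.
Proof. by rewrite /sigman iterSr /= comp_polyX. Qed.

Lemma reg_rel_hx v : reg_h 'X (reg_x v) = reg_x (reg_h f v).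
Proof.
apply/funext => -[|i]; apply/funext => j; first by rewrite /reg_h /= mulr0.
by rewrite /reg_h /reg_x sigmanXS.
Qed.

Lemma reg_rel_yh v : reg_y (reg_h 'X v) = reg_h f (reg_y v).
Proof.
apply/funext => i; apply/funext => j; rewrite /reg_h /reg_y mulrDr.
rewrite sigmanXS mulrCA; congr (_ + _).
case: j => [|j]; first by rewrite mulr0.
by rewrite comp_polyM -sigmanXS sigmanS scalerAr.
Qed.

Lemma reg_rel_yx v : reg_y (reg_x v) = q *: reg_x (reg_y v) + reg_h g v.
Proof.
apply/funext => i; apply/funext => j.
rewrite reg_linE /reg_h /reg_y /reg_x.
case: i => [|i] /=.
  rewrite yx_coefS scaler0 !add0r.
  by case: j => [|j]; rewrite ?comp_poly0 ?scaler0 add0r.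
rewrite yx_coefS [X in _ = X + _]scalerDr -addrA mulrDl -scalerAl; congr (_ + _).
by case: j => [|j]; rewrite ?scaler0 // scalerA -exprS.
Qed.

Lemma reg_act_x v : reg_act (free_gen F 0) v = reg_x v.
Proof. exact: free_act_gen. Qed.

Lemma reg_act_y v : reg_act (free_gen F 1) v = reg_y v.
Proof. exact: free_act_gen. Qed.

Lemma reg_act_h v : reg_act (free_gen F 2) v = reg_h 'X v.
Proof. exact: free_act_gen. Qed.

(** The array action factors through the presented algebra. *)
Lemma reg_act_rel r v : qgha_rel q f g r -> reg_act r v = 0.
Proof.
case=> ->.
- rewrite free_act_rel2 reg_act_eval 2!reg_act_x reg_act_h reg_rel_hx.
  by rewrite subrr.
- rewrite free_act_rel2 reg_act_eval 2!reg_act_y reg_act_h reg_rel_yh.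
  by rewrite subrr.
rewrite free_act_rel3 reg_act_eval 2!reg_act_y 2!reg_act_x reg_rel_yx.
by rewrite addrAC addrK subrr.
Qed.

End RegularModule.

(** * Normal ordering of products *)
Section NormalOrdering.
Context (F : fieldType) (q : F) (f g : {poly F}) (B : algType F) (x y h : B).
Implicit Types p : {poly F}.
Local Notation "p %:H" := (horner_alg h p) (at level 2, format "p %:H").
Hypothesis hx : h * x = x * f%:H.
Hypothesis yh : y * h = f%:H * y.
Hypothesis yx : y * x - q *: (x * y) = g%:H.

Lemma horner_algZ c p : (c *: p)%:H = c *: p%:H.
Proof. by rewrite linearZ /= -scalerAl mul1r. Qed.

Lemma horner_mul_x p : p%:H * x = x * (p \Po f)%:H.
Proof.
elim/poly_ind: p => [|p a IHp]; first by rewrite comp_poly0 !rmorph0 mul0r mulr0.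
rewrite comp_polyD comp_polyM comp_polyX comp_polyC !rmorphD !rmorphM /=.
rewrite !horner_algX !horner_algC mulrDl mulrDr -mulrA hx mulrA IHp -mulrA.
by rewrite -scalerAl -scalerAr mul1r mulr1.
Qed.

Lemma mul_y_horner p : y * p%:H = (p \Po f)%:H * y.
Proof.
elim/poly_ind: p => [|p a IHp]; first by rewrite comp_poly0 !rmorph0 mul0r mulr0.
rewrite comp_polyD comp_polyM comp_polyX comp_polyC !rmorphD !rmorphM /=.
rewrite !horner_algX !horner_algC mulrDl mulrDr mulrA IHp -(mulrA _ y h) yh mulrA.
by rewrite -scalerAl -scalerAr mul1r mulr1.
Qed.

Lemma horner_mul_xn p i : p%:H * x ^+ i = x ^+ i * (sigman f i p)%:H.
Proof.
elim: i => [|i IHi]; first by rewrite mul1r mulr1.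
by rewrite exprSr mulrA IHi -[LHS]mulrA horner_mul_x mulrA.
Qed.

Lemma mul_yn_horner p j : y ^+ j * p%:H = (sigman f j p)%:H * y ^+ j.
Proof.
elim: j => [|j IHj]; first by rewrite mul1r mulr1.
by rewrite exprS -[LHS]mulrA IHj mulrA mul_y_horner mulrA.
Qed.

Let yxE : y * x = q *: (x * y) + g%:H.
Proof. by rewrite -yx addrC subrK. Qed.

(** One factor yx is reordered at the left end, x^i then passes to the left of
    g(h): this matches the recursion c_{n+1} = q c_n + s^n(g). *)
Lemma mul_y_xn i :
  y * x ^+ i.+1 = q ^+ i.+1 *: (x ^+ i.+1 * y) + x ^+ i * (yx_coef q f g i.+1)%:H.
Proof.
elim: i => [|i IHi]; first by rewrite !expr1 mul1r yxE yx_coefS scaler0 add0r.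
rewrite [in LHS]exprS mulrA yxE mulrDl horner_mul_xn [in RHS]yx_coefS.
move: (yx_coef q f g i.+1) IHi => c IHi.
rewrite -scalerAl -mulrA IHi mulrDr scalerDr -scalerAr scalerA -exprS !mulrA.
rewrite -!exprS -addrA linearD linearZ /= mulrDr.
by rewrite -scalerAl mul1r -scalerAr.
Qed.

(** The same c_n appears as in [mul_y_xn], because the relations are symmetric
    under the exchange of x and y with reversal of products. *)
Lemma mul_yn_x j :
  y ^+ j.+1 * x = q ^+ j.+1 *: (x * y ^+ j.+1) + (yx_coef q f g j.+1)%:H * y ^+ j.
Proof.
elim: j => [|j IHj]; first by rewrite !expr1 mulr1 yxE yx_coefS scaler0 add0r.
rewrite [in LHS]exprSr -mulrA yxE mulrDr mul_yn_horner [in RHS]yx_coefS.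
move: (yx_coef q f g j.+1) IHj => c IHj.
rewrite -scalerAr mulrA IHj mulrDl scalerDr -scalerAl scalerA -exprS -!mulrA.
rewrite -!exprSr -addrA linearD linearZ /= mulrDl.
by rewrite -scalerAl mul1r -scalerAl.
Qed.

Definition pbw_mono i p j : B := x ^+ i * p%:H * y ^+ j.

Lemma mul_x_pbw i p j : x * pbw_mono i p j = pbw_mono i.+1 p j.
Proof. by rewrite /pbw_mono !mulrA -exprS. Qed.

Lemma mul_horner_pbw p i p' j :
  p%:H * pbw_mono i p' j = pbw_mono i (sigman f i p * p') j.
Proof.
rewrite /pbw_mono !mulrA horner_mul_xn -[in LHS](mulrA (x ^+ i)).
by rewrite -rmorphM.
Qed.

Lemma mul_y_pbw0 p j : y * pbw_mono 0 p j = pbw_mono 0 (p \Po f) j.+1.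
Proof. by rewrite /pbw_mono !mul1r mulrA mul_y_horner -mulrA -exprS. Qed.

Lemma mul_y_pbwS i p j : y * pbw_mono i.+1 p j =
  pbw_mono i.+1 (q ^+ i.+1 *: (p \Po f)) j.+1
    + pbw_mono i (yx_coef q f g i.+1 * p) j.
Proof.
rewrite /pbw_mono !mulrA mul_y_xn; move: (yx_coef _ _ _ _) => c.
rewrite !mulrDl -!scalerAl -(mulrA _ y) mul_y_horner horner_algZ rmorphM /=.
by rewrite -scalerAr -scalerAl !mulrA -(mulrA _ y) -exprS.
Qed.

Lemma mul_pbw_h i p j : pbw_mono i p j * h = pbw_mono i (sigman f j 'X * p) j.
Proof.
rewrite /pbw_mono -mulrA -[X in _ * (_ * X)](horner_algX h) mul_yn_horner !mulrA.
by congr (_ * _); rewrite -mulrA -rmorphM mulrC.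
Qed.

Lemma mul_pbw0_x i p : pbw_mono i p 0 * x = pbw_mono i.+1 (p \Po f) 0.
Proof. by rewrite /pbw_mono !mulr1 -mulrA horner_mul_x mulrA -exprSr. Qed.

Lemma mul_pbwS_x i p j : pbw_mono i p j.+1 * x =
  pbw_mono i.+1 (q ^+ j.+1 *: (p \Po f)) j.+1
    + pbw_mono i (yx_coef q f g j.+1 * p) j.
Proof.
rewrite /pbw_mono -mulrA mul_yn_x; move: (yx_coef _ _ _ _) => c.
rewrite mulrDr -scalerAr !mulrA -(mulrA _ _ x) horner_mul_x horner_algZ.
rewrite -scalerAr -scalerAl mulrA -exprSr; congr (_ + _ * _).
by rewrite -mulrA -rmorphM mulrC.
Qed.

Section Conformal.
Context (a : {poly F}).
Hypothesis ga : g = a \Po f - q *: a.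
Let Z : B := q *: (x * y - a%:H).

Let gaH : g%:H = (a \Po f)%:H - q *: a%:H.
Proof. by rewrite ga rmorphB /= horner_algZ. Qed.

(** Moving x or y across w = x y - a(h) turns w into y x - (s a)(h), which
    equals q x y + g(h) - (s a)(h) = q w because g = s a - q a. *)
Lemma conformal_Zx : Z * x = q *: (x * Z).
Proof.
rewrite /Z -scalerAl mulrBl -mulrA yxE horner_mul_x -mulrBr gaH.
congr (_ *: (_ * _)).
by rewrite scalerBr -addrA [_ - _ - _]addrAC subrr add0r.
Qed.

Lemma conformal_yZ : y * Z = q *: (Z * y).
Proof.
rewrite /Z -scalerAr mulrBr mulrA yxE mul_y_horner -mulrBl gaH.
congr (_ *: (_ * _)).
by rewrite scalerBr -addrA [_ - _ - _]addrAC subrr add0r.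
Qed.

Lemma conformal_Zh : GRing.comm Z h.
Proof.
have ah : a%:H * h = h * a%:H by rewrite -{2 3}(horner_algX h) -!rmorphM mulrC.
rewrite /GRing.comm /Z -scalerAl -scalerAr mulrBl mulrBr ah.
by rewrite -mulrA yh !mulrA hx.
Qed.

End Conformal.
End NormalOrdering.

(** * Powers of quasi-commuting elements *)
Section QuasiCommute.
Context (F : fieldType) (B : algType F) (q : F) (u v : B).

Lemma qcomm_expl n : u * v = q *: (v * u) -> u ^+ n * v = q ^+ n *: (v * u ^+ n).
Proof.
move=> uv; elim: n => [|n IHn]; first by rewrite mul1r mulr1 scale1r.
rewrite exprSr -[LHS]mulrA uv -scalerAr (mulrA _ v) IHn -scalerAl scalerA.
by rewrite -exprS -mulrA.
Qed.

Lemma qcomm_expr n : u * v = q *: (v * u) -> u * v ^+ n = q ^+ n *: (v ^+ n * u).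
Proof.
move=> uv; elim: n => [|n IHn]; first by rewrite mul1r mulr1 scale1r.
rewrite exprS [LHS]mulrA uv -scalerAl -(mulrA v u) IHn -scalerAr scalerA.
by rewrite -!exprS mulrA -exprS.
Qed.

End QuasiCommute.

(** * The center in terms of coefficients *)
Section PBW.
Context (F : fieldType) (q : F) (f g : {poly F}) (B : algType F) (x y h : B).
Implicit Types (p : {poly F}) (z : B).
Local Notation "p %:H" := (horner_alg h p) (at level 2, format "p %:H").
Local Notation mono := (pbw_mono x y h).
Hypothesis hx : h * x = x * f%:H.
Hypothesis yh : y * h = f%:H * y.
Hypothesis yx : y * x - q *: (x * y) = g%:H.
(* The terms x^i p(h) y^j span B additively; [coord_mono] below expresses that
   their coefficients are unique. *)
Hypothesis pbw_span : forall P : B -> Prop,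
  (forall i p j, P (mono i p j)) -> (forall z1 z2, P z1 -> P z2 -> P (z1 + z2)) ->
  forall z, P z.
Variable coord : B -> nat -> nat -> {poly F}.
Hypothesis coordD : forall z1 z2 i j,
  coord (z1 + z2) i j = coord z1 i j + coord z2 i j.
Hypothesis coord_mono : forall i p j i' j',
  coord (mono i p j) i' j' = if (i' == i) && (j' == j) then p else 0.

Lemma monoZ c i p j : mono i (c *: p) j = c *: mono i p j.
Proof. by rewrite /pbw_mono horner_algZ -scalerAr -scalerAl. Qed.

Lemma coordZ c z i j : coord (c *: z) i j = c *: coord z i j.
Proof.
elim/pbw_span: z => [i' p j'|z1 z2 IH1 IH2]; last first.
  by rewrite scalerDr !coordD IH1 IH2 scalerDr.
by rewrite -monoZ !coord_mono; case: ifP; rewrite ?scaler0.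
Qed.

Lemma coordB z1 z2 i j : coord (z1 - z2) i j = coord z1 i j - coord z2 i j.
Proof. by rewrite -scaleN1r coordD coordZ scaleN1r. Qed.

Lemma coord1 i j : coord 1 i j = if (i == 0%N) && (j == 0%N) then 1 else 0.
Proof.
by rewrite -(coord_mono 0 1 0) /pbw_mono rmorph1 !mulr1.
Qed.

Lemma coord_xM z i j : coord (x * z) i j = if i is k.+1 then coord z k j else 0.
Proof.
elim/pbw_span: z => [i' p j'|z1 z2 IH1 IH2]; last first.
  by rewrite mulrDr !coordD IH1 IH2; case: i {IH1 IH2} => [|i]; rewrite ?addr0.
by rewrite mul_x_pbw coord_mono; case: i => [|i] //; rewrite coord_mono.
Qed.

Lemma coord_hornerM p z i j : coord (p%:H * z) i j = sigman f i p * coord z i j.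
Proof.
elim/pbw_span: z => [i' p' j'|z1 z2 IH1 IH2]; last first.
  by rewrite mulrDr !coordD IH1 IH2 mulrDr.
rewrite (mul_horner_pbw _ hx) !coord_mono.
by case: eqP => [->|_]; case: eqP => _; rewrite ?mulr0.
Qed.

Lemma coord_yM z i j : coord (y * z) i j =
  (if j is k.+1 then q ^+ i *: (coord z i k \Po f) else 0)
    + yx_coef q f g i.+1 * coord z i.+1 j.
Proof.
elim/pbw_span: z => [i' p j'|z1 z2 IH1 IH2]; last first.
  rewrite mulrDr !coordD IH1 IH2 mulrDr addrACA; congr (_ + _).
  by case: j {IH1 IH2} => [|j]; rewrite ?addr0 // coordD comp_polyD scalerDr.
case: i' => [|i'].
  rewrite (mul_y_pbw0 _ yh) !coord_mono mulr0 addr0.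
  case: j => [|j]; first by rewrite andbF.
  rewrite coord_mono eqSS; case: eqP => [->|_]; last by rewrite comp_poly0 scaler0.
  by case: eqP => _; rewrite ?comp_poly0 scale1r.
rewrite (mul_y_pbwS hx yh yx).
rewrite coordD !coord_mono eqSS; congr (_ + _).
  case: j => [|j]; first by rewrite andbF.
  rewrite coord_mono eqSS; case: eqP => [->|_]; last by rewrite comp_poly0 scaler0.
  by case: eqP => _; rewrite ?comp_poly0 ?scaler0.
by case: eqP => [->|_]; case: eqP => _; rewrite ?mulr0.
Qed.

Lemma coord_Mh z i j : coord (z * h) i j = sigman f j 'X * coord z i j.
Proof.
elim/pbw_span: z => [i' p j'|z1 z2 IH1 IH2]; last first.
  by rewrite mulrDl !coordD IH1 IH2 mulrDr.
rewrite (mul_pbw_h _ yh) !coord_mono.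
by case: eqP => _; case: eqP => [->|_]; rewrite ?mulr0.
Qed.

(** The mirror image of [coord_yM]. *)
Lemma coord_Mx z i j : coord (z * x) i j =
  (if i is k.+1 then q ^+ j *: (coord z k j \Po f) else 0)
    + yx_coef q f g j.+1 * coord z i j.+1.
Proof.
elim/pbw_span: z => [i' p j'|z1 z2 IH1 IH2]; last first.
  rewrite mulrDl !coordD IH1 IH2 mulrDr addrACA; congr (_ + _).
  by case: i {IH1 IH2} => [|i]; rewrite ?addr0 // coordD comp_polyD scalerDr.
case: j' => [|j'].
  rewrite (mul_pbw0_x _ hx) !coord_mono andbF mulr0 addr0.
  case: i => [|i] //; rewrite coord_mono eqSS.
  case: eqP => _; last by rewrite comp_poly0 scaler0.
  by case: eqP => [->|_]; rewrite ?comp_poly0 ?scaler0 ?scale1r.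
rewrite (mul_pbwS_x hx yh yx).
rewrite coordD !coord_mono eqSS; congr (_ + _).
  case: i => [|i] //; rewrite coord_mono eqSS.
  case: eqP => _; last by rewrite comp_poly0 scaler0.
  by case: eqP => [->|_]; rewrite ?comp_poly0 ?scaler0.
by case: eqP => _; case: eqP => [->|_]; rewrite ?mulr0.
Qed.

Lemma coord_finite z : exists n, forall i j, (n <= i)%N -> coord z i j = 0.
Proof.
elim/pbw_span: z => [i' p j'|z1 z2 [n1 z10] [n2 z20]].
  by exists i'.+1 => i j lti; rewrite coord_mono gtn_eqF.
exists (maxn n1 n2) => i j; rewrite geq_max => /andP[n1i n2i].
by rewrite coordD z10 // z20 // addr0.
Qed.

(** Any large enough square of indices may be used, so that the expansions of
    two elements can be added over a common one. *)
Lemma coord_expand z : exists n, forall m, (n <= m)%N ->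
  z = \sum_(i < m) \sum_(j < m) mono i (coord z i j) j.
Proof.
have monoD i p1 p2 j : mono i (p1 + p2) j = mono i p1 j + mono i p2 j.
  by rewrite /pbw_mono rmorphD mulrDr mulrDl.
have mono0 i j : mono i 0 j = 0 by rewrite /pbw_mono rmorph0 mulr0 mul0r.
elim/pbw_span: z => [i p j|z1 z2 [n1 z1E] [n2 z2E]].
  exists (maxn i j).+1 => m; rewrite gtn_max => /andP[im jm].
  rewrite (bigD1 (Ordinal im)) //= (bigD1 (Ordinal jm)) //= coord_mono !eqxx /=.
  rewrite !big1 ?addr0 //.
    move=> k neqk; rewrite big1 // => k' _.
    by rewrite coord_mono (negPf (neqk : k != i :> nat)) mono0.
  by move=> k neqk; rewrite coord_mono eqxx (negPf (neqk : k != j :> nat)) mono0.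
exists (maxn n1 n2) => m; rewrite geq_max => /andP[n1m n2m].
rewrite {1}(z1E m) // {1}(z2E m) // -big_split; apply: eq_bigr => i _.
by rewrite -big_split; apply: eq_bigr => j _; rewrite coordD monoD.
Qed.

Lemma coord_eq0 z : (forall i j, coord z i j = 0) -> z = 0.
Proof.
have [n zE] := coord_expand z => z0; rewrite (zE n) //.
rewrite big1 // => i _; rewrite big1 // => j _.
by rewrite z0 /pbw_mono rmorph0 mulr0 mul0r.
Qed.

Hypothesis hf : (2 < size f)%N.

Lemma size_sigman n : (size (sigman f n 'X)).-1 = ((size f).-1 ^ n)%N.
Proof.
elim: n => [|n IHn]; first by rewrite /sigman size_polyX.
by rewrite sigmanS size_comp_poly IHn expnSr.
Qed.

(** The degrees (deg f)^i tell the iterates apart. *)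
Lemma sigman_inj i j : sigman f i 'X = sigman f j 'X -> i = j.
Proof.
move=> /(congr1 (fun p : {poly F} => (size p).-1)); rewrite !size_sigman.
by apply: expnI; rewrite -ltnS prednK // (leq_trans _ hf).
Qed.

(** From z h = h z: the coefficients are killed by s^j(h) - s^i(h), which is
    not zero for i != j. *)
Lemma center_coord_diag z i j : center B z -> i != j -> coord z i j = 0.
Proof.
move=> Cz neq_ij; have /(congr1 (fun w => coord w i j)) := Cz h.
rewrite coord_Mh -[X in coord (X * _)](horner_algX h) coord_hornerM => /eqP.
rewrite -subr_eq0 -mulrBl mulf_eq0 subr_eq0 => /orP[/eqP /sigman_inj eq_ji|/eqP //].
by rewrite eq_ji eqxx in neq_ij.
Qed.

(** The coefficients of x z and z x at x^(i+1) y^i. *)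
Lemma center_coord_rec z i : center B z ->
  coord z i i = q ^+ i *: (coord z i i \Po f)
                + yx_coef q f g i.+1 * coord z i.+1 i.+1.
Proof.
move=> Cz; have /(congr1 (fun w => coord w i.+1 i)) := Cz x.
by rewrite coord_Mx coord_xM => ->.
Qed.

(** A nonzero p with p = q^n s(p) has deg p = deg p * deg f, hence degree 0
    because deg f > 1; and s fixes constants. *)
Lemma center_coord_top z n : center B z -> coord z n.+1 n.+1 = 0 ->
  coord z n n != 0 -> q ^+ n = 1 /\ exists2 c, c != 0 & coord z n n = c%:P.
Proof.
move=> Cz zS0; have := center_coord_rec n Cz; rewrite zS0 mulr0 addr0.
move: (coord z n n) => p pE p0.
have qn0 : q ^+ n != 0 by apply: contraNneq p0 => qn0; rewrite pE qn0 scale0r.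
have /size_poly1P [c c0 pc] : size p == 1%N.
  have : (size p).-1 = ((size p).-1 * (size f).-1)%N.
    by rewrite {1}pE size_scale // size_comp_poly.
  have : (0 < size p)%N by rewrite size_poly_gt0.
  case: (size p) => [//|m] _ /=; case: m => // m.
  case: (size f) hf => [|[|[|k]]] //= _ /eqP.
  by rewrite -{1}[m.+1]muln1 eqn_pmul2l.
split; last by exists c.
move: pE; rewrite pc comp_polyC -mul_polyC -polyCM => /polyC_inj /eqP.
by rewrite -{1}[c]mul1r (inj_eq (mulIf c0)) => /eqP <-.
Qed.

Lemma centerB z1 z2 : center B z1 -> center B z2 -> center B (z1 - z2).
Proof. by move=> C1 C2 w; rewrite /GRing.comm mulrBl mulrBr C1 C2. Qed.

Lemma centerZ c z : center B z -> center B (c *: z).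
Proof. by move=> Cz w; rewrite /GRing.comm -scalerAl Cz scalerAr. Qed.

Lemma center_diag_eq0 z : center B z -> (forall n, coord z n n = 0) -> z = 0.
Proof.
move=> Cz z0; apply: coord_eq0 => i j; have [->//|] := eqVneq i j.
exact: center_coord_diag.
Qed.

Lemma center_scalar c : center B c%:A.
Proof. by move=> w; rewrite /GRing.comm -scalerAl -scalerAr mul1r mulr1. Qed.

(** The induction is on a strict bound n for the indices i with z_ii != 0. *)
Lemma center_trivial : (forall n, (0 < n)%N -> q ^+ n != 1) ->
  center B = [set c%:A | c in [set: F]].
Proof.
move=> qN1; apply/seteqP; split=> [z Cz|_ [c _ <-]]; last exact: center_scalar.
have [n zn0] := coord_finite z.
have {zn0} : forall i, (n <= i)%N -> coord z i i = 0 by move=> i; apply: zn0.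
elim: n => [|n IHn] zn0.
  by exists 0; rewrite // scale0r (center_diag_eq0 Cz) // => i; apply: zn0.
have [znn0|znn0] := eqVneq (coord z n n) 0.
  by apply: IHn => i; rewrite leq_eqVlt => /predU1P[<-|/zn0].
have [qn1 [c c0 zc]] := center_coord_top Cz (zn0 _ (leqnn _)) znn0.
case: n {IHn} zn0 znn0 qn1 zc => [|n] zn0 _ qn1 zc; last first.
  by have := qN1 n.+1 isT; rewrite qn1 eqxx.
exists c => //; apply/esym/eqP; rewrite -subr_eq0; apply/eqP.
apply: center_diag_eq0 => [|i]; first exact: centerB Cz (center_scalar c).
rewrite coordB coordZ coord1; case: i => [|i] /=.
  by rewrite zc alg_polyC subrr.
by rewrite zn0 // scaler0 subr0.
Qed.

Section Conformal.
Variables (l : nat) (a : {poly F}).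
Hypothesis ql : l.-primitive_root q.
Hypothesis ga : g = a \Po f - q *: a.
Let Z : B := q *: (x * y - a%:H).

Lemma center_gen z : GRing.comm z x -> GRing.comm z y -> GRing.comm z h ->
  center B z.
Proof.
move=> zx zy zh; elim/pbw_span => [i p j|w1 w2 c1 c2]; last exact: commrD.
apply: commrM; last exact: commrX.
apply: commrM; first exact: commrX.
elim/poly_ind: p => [|p c IHp]; first by rewrite rmorph0; exact: commr0.
rewrite rmorphD rmorphM /= horner_algX horner_algC.
by apply: commrD; [apply: commrM | apply: commr_sym; apply: center_scalar].
Qed.

(** Moving Z^l across x or y costs the factor q^l = 1. *)
Lemma conformal_center : center B (Z ^+ l).
Proof.
apply: center_gen; rewrite /GRing.comm.
- rewrite (qcomm_expl _ (conformal_Zx hx yx ga)).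
  by rewrite (prim_expr_order ql) scale1r.
- rewrite (qcomm_expr _ (conformal_yZ yh yx ga)).
  by rewrite (prim_expr_order ql) scale1r.
exact/commr_sym/commrX/commr_sym/(conformal_Zh q hx yh a).
Qed.

Lemma coord_ZM z i j : coord (Z * z) i.+1 j =
  q *: (coord (y * z) i j - sigman f i.+1 a * coord z i.+1 j).
Proof.
by rewrite -scalerAl coordZ mulrBl coordB -mulrA coord_xM coord_hornerM.
Qed.

(** Multiplying by Z = q (x y - a(h)) raises the exponent of x by at most
    one. *)
Lemma coord_Zn_gt n i j : (n < i)%N -> coord (Z ^+ n) i j = 0.
Proof.
elim: n i j => [|n IHn] i j; first by rewrite coord1; case: i.
case: i => [//|i] lt_ni; rewrite exprS coord_ZM coord_yM !IHn //; last exact: ltnW.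
case: j => [|j]; first by rewrite !mulr0 addr0 subr0 scaler0.
by rewrite IHn // comp_poly0 scaler0 !mulr0 addr0 subr0 scaler0.
Qed.

(** The top coefficient gets multiplied by q^(n+1) from Z^n to Z^(n+1): one q
    from the definition of Z and q^n from y x^n = q^n x^n y + ...; q is
    invertible as a root of unity. *)
Lemma coord_Zn_top n : exists2 c, c != 0 & coord (Z ^+ n) n n = c%:P.
Proof.
have q0 : q != 0.
  have := prim_expr_order ql; apply: contra_eq_neq => ->; rewrite expr0n.
  by rewrite gtn_eqF ?(prim_order_gt0 ql) // eq_sym oner_neq0.
elim: n => [|n [c c0 zc]]; first by exists 1; rewrite ?oner_neq0 // coord1.
exists (q * (q ^+ n * c)); first by rewrite !mulf_neq0 ?expf_neq0.
rewrite exprS coord_ZM coord_yM !(coord_Zn_gt _ (ltnSn n)) !mulr0 addr0 subr0.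
by rewrite zc comp_polyC -!mul_polyC !polyCM.
Qed.

(** The induction is on a strict bound n for the indices i with z_ii != 0; a
    suitable multiple of Z^n cancels the last diagonal coefficient. *)
Lemma center_conformal : center B = subalg_gen [set Z ^+ l].
Proof.
apply/seteqP; split=> [z Cz|z]; last first.
  elim=> {z} [_ ->||c u v _ Cu _ Cv|u v _ Cu _ Cv].
  - exact: conformal_center.
  - by rewrite -[1]scale1r; apply: center_scalar.
  - move=> w; rewrite /GRing.comm mulrDl mulrDr -scalerAl -scalerAr.
    by rewrite (Cu w) (Cv w).
  - move=> w; apply: commr_sym; apply: commrM; apply: commr_sym.
      exact: Cu.
    exact: Cv.
have [n zn0] := coord_finite z.
have {zn0} : forall i, (n <= i)%N -> coord z i i = 0 by move=> i; apply: zn0.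
elim: n z Cz => [|n IHn] z Cz zn0.
  rewrite (center_diag_eq0 Cz) // => [|i]; last exact: zn0.
  rewrite -[0](addNr 1) -scaleN1r; apply: subalg_gen_lin; exact: subalg_gen_one.
have [znn0|znn0] := eqVneq (coord z n n) 0.
  by apply: IHn => // i; rewrite leq_eqVlt => /predU1P[<-|/zn0].
have [qn1 [c c0 zc]] := center_coord_top Cz (zn0 _ (leqnn _)) znn0.
have [d d0 Zd] := coord_Zn_top n.
have /dvdnP [k nE] : (l %| n)%N by rewrite (prim_order_dvd ql) qn1.
have ZnX : Z ^+ n = (Z ^+ l) ^+ k by rewrite -exprM mulnC -nE.
have ZnS : subalg_gen [set Z ^+ l] (Z ^+ n).
  rewrite ZnX; elim: (k) => [|k' IHk]; first exact: subalg_gen_one.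
  by rewrite exprS; apply: subalg_gen_mul => //; apply: subalg_gen_mem.
have ZnC : center B (Z ^+ n).
  by rewrite ZnX => w; apply/commr_sym/commrX/commr_sym; apply: conformal_center.
rewrite -[z](subrK ((c / d) *: Z ^+ n)) addrC; apply: subalg_gen_lin => //.
apply: IHn => [|i]; first exact: centerB Cz (centerZ _ ZnC).
rewrite leq_eqVlt coordB coordZ => /predU1P[<-|lt_ni].
  by rewrite zc Zd -mul_polyC -polyCM divfK // subrr.
by rewrite zn0 // coord_Zn_gt // scaler0 subr0.
Qed.

End Conformal.
End PBW.

(** * Coefficients in the presented algebra *)
Section QghaCoordinates.
Context (F : fieldType) (q : F) (f g : {poly F}).
Implicit Types (p : {poly F}).

Local Notation A := (qgha q f g).
Local Notation x := (qx q f g).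
Local Notation y := (qy q f g).
Local Notation h := (qh q f g).
Local Notation "p %:H" := (horner_alg h p) (at level 2, format "p %:H").
Local Notation mono := (pbw_mono x y h).
Implicit Types z : A.

(** Every element is a sum of scalar multiples of words in the generators, and
    left multiplication by a generator sends a term x^i p(h) y^j to a sum of at
    most two such terms. *)
Lemma qgha_pbw_span (P : A -> Prop) :
    (forall i p j, P (mono i p j)) -> (forall z1 z2, P z1 -> P z2 -> P (z1 + z2)) ->
  forall z, P z.
Proof.
move=> Pmono PD z; rewrite -[z]qgha_reprK [repr z]monalgE.
have P0 : P 0.
  by have := Pmono 0%N 0 0%N; rewrite /pbw_mono rmorph0 mulr0 mul0r.
elim: (msupp (repr z) : seq _) => [|m ms IHms].
  by rewrite big_nil qgha_pi0.
rewrite big_cons qgha_piD; apply: (PD); last exact: IHms.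
move: (_@_m) => c; case: m {IHms} => w.
(* P is generalized: for the word i :: w the hypothesis is applied to the
   predicate that holds of z when P holds of the generator i times z. *)
elim: w P Pmono PD P0 => [|i w IHw] P Pmono PD P0.
  have -> : << c *g FMonom [::] >> = c *: 1 :> free_alg F 'I_3.
    by rewrite -mul_malgC mulr1 /malgC /mone /= /fmone fmE.
  have := Pmono 0%N c%:P 0%N.
  by rewrite /pbw_mono !expr0 mulr1 mul1r horner_algC qgha_piZ.
have -> : << c *g FMonom (i :: w) >> =
          free_gen F i * << c *g FMonom w >> :> free_alg F 'I_3.
  by rewrite malgM_def fgmulUU mul1r /mmul /= /fmmul /fmu !fmE.
have -> u : qgha_pi q f g (free_gen F i * u) =
    qgha_pi q f g (free_gen F i) * qgha_pi q f g u by exact: qgha_piM.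
apply: (IHw (fun z => P (qgha_pi q f g (free_gen F i) * z)))
  => [i' p j|z1 z2 P1 P2|]; last 2 first.
- by rewrite mulrDr; apply: (PD).
- by rewrite mulr0.
have : [\/ i = 0, i = 1 | i = 2].
  case: i => -[|[|[|//]]] lti; [apply: Or31|apply: Or32|apply: Or33]; exact/val_inj.
case=> ->.
- rewrite -/x mul_x_pbw; exact: Pmono.
- rewrite -/y; case: i' => [|i'].
    by rewrite (mul_y_pbw0 _ (qgha_yh q f g)); apply: Pmono.
  rewrite (mul_y_pbwS (qgha_hx q f g) (qgha_yh q f g) (qgha_yx q f g)).
  by apply: (PD); apply: Pmono.
rewrite -/h -[X in X * _](horner_algX h) (mul_horner_pbw _ (qgha_hx q f g)).
exact: Pmono.
Qed.

Definition reg_one : nat -> nat -> {poly F} :=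
  fun i j => ((i == 0%N) && (j == 0%N))%:R.

(** The choice of the representative is immaterial, since the ideal acts by
    zero on arrays: see [qgha_coord_pi]. *)
Definition qgha_coord z : nat -> nat -> {poly F} :=
  free_act (reg_gen q f g) (repr z) reg_one.

Lemma qgha_coord_pi u :
  qgha_coord (qgha_pi q f g u) = free_act (reg_gen q f g) u reg_one.
Proof.
apply/eqP; rewrite -subr_eq0 -free_actN -free_actD; apply/eqP.
by apply: free_act_ideal (qgha_repr_pi q f g u) => r v; apply: reg_act_rel.
Qed.

Lemma qgha_coord_piM u z :
  qgha_coord (qgha_pi q f g u * z) = free_act (reg_gen q f g) u (qgha_coord z).
Proof.
rewrite -[z]qgha_reprK; set v := repr z.
rewrite -[_ * _](qgha_piM q f g u v).
by rewrite !qgha_coord_pi free_actM.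
Qed.

Lemma qgha_coord1 : qgha_coord 1 = reg_one.
Proof. by rewrite -[1]/(qgha_pi q f g 1) qgha_coord_pi free_act1. Qed.

Lemma qgha_coordD z1 z2 i j :
  qgha_coord (z1 + z2) i j = qgha_coord z1 i j + qgha_coord z2 i j.
Proof.
rewrite -[z1]qgha_reprK -[z2]qgha_reprK -qgha_piD !qgha_coord_pi free_actD.
by [].
Qed.

Lemma qgha_coord_xM z i j :
  qgha_coord (x * z) i j = if i is k.+1 then qgha_coord z k j else 0.
Proof. by rewrite qgha_coord_piM reg_act_x. Qed.

Lemma qgha_coord_yM z i j : qgha_coord (y * z) i j =
  (if j is k.+1 then q ^+ i *: (qgha_coord z i k \Po f) else 0)
    + yx_coef q f g i.+1 * qgha_coord z i.+1 j.
Proof. by rewrite qgha_coord_piM reg_act_y. Qed.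

Lemma qgha_coord_hornerM p z i j :
  qgha_coord (p%:H * z) i j = sigman f i p * qgha_coord z i j.
Proof. by rewrite -qgha_pi_eval qgha_coord_piM reg_act_eval. Qed.

Lemma qgha_coord_yn n i j : qgha_coord (y ^+ n) i j = ((i == 0%N) && (j == n))%:R.
Proof.
elim: n i j => [|n IHn] i j; first by rewrite qgha_coord1.
rewrite exprS qgha_coord_yM !IHn mulr0 addr0.
case: j => [|j]; first by rewrite andbF.
rewrite IHn eqSS; case: i => [|i]; last by rewrite comp_poly0 scaler0.
by rewrite scale1r; case: (j == n); rewrite ?comp_poly0 ?rmorph1.
Qed.

(** The uniqueness of the coefficients: applying x^i p(h) y^j to the array of 1
    builds the array of this very term. *)
Lemma qgha_coord_mono i p j i' j' :
  qgha_coord (mono i p j) i' j' = if (i' == i) && (j' == j) then p else 0.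
Proof.
rewrite /pbw_mono -mulrA; elim: i i' => [|i IHi] i'.
  rewrite mul1r qgha_coord_hornerM qgha_coord_yn.
  by case: i' => [|i'] /=; rewrite ?mulr0 //; case: eqP; rewrite ?mulr1 ?mulr0.
by rewrite exprS -[x * _ * _]mulrA qgha_coord_xM; case: i' => [|i'].
Qed.

End QghaCoordinates.

Theorem proposition2p9 (F : fieldType) (q : F) (f g : {poly F})
    (hf : (2 < size f)%N) :
  ((forall n : nat, (0 < n)%N -> ~~ n.-unity_root q) ->
     center (qgha q f g) = [set c%:A | c in [set: F]]) /\
  (forall (l : nat) (a : {poly F}),
     l.-primitive_root q -> g = sigma f a - q *: a ->
     let Z : qgha q f g :=
       q *: (qx q f g * qy q f g - horner_alg (qh q f g) a) in
     center (qgha q f g) = subalg_gen [set Z ^+ l]).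
Proof.
split=> [qN1|l a ql ga Z].
  apply: (center_trivial (qgha_hx q f g) (qgha_yh q f g) (qgha_yx q f g)
    (@qgha_pbw_span F q f g) (@qgha_coordD F q f g) (@qgha_coord_mono F q f g))
    => // n n0.
  by rewrite -unity_rootE qN1.
exact: (center_conformal (qgha_hx q f g) (qgha_yh q f g) (qgha_yx q f g)
  (@qgha_pbw_span F q f g) (@qgha_coordD F q f g) (@qgha_coord_mono F q f g)
  hf ql ga).
Qed.
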